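(* Let $n > 1$, let $\Delta$ be a division ring, and let $\mathcal{S}$ be a finite semigroup in $M_n(\Delta)$ consisting of matrices of the form $cI + N$, where $c$ is in the center of $\Delta$ and $N \in M_n(\Delta)$ is nilpotent. Then the semigroup $\mathcal{S}$ is triangularizable.
   Context: $M_n(\Delta)$ is the algebra (ring) of all $n\times n$ matrices over the division ring $\Delta$, and $I$ is the identity matrix. A semigroup $\mathcal{S} \subseteq M_n(\Delta)$ is a set of matrices closed under multiplication. Members of $M_n(\Delta)$ are viewed as linear transformations acting on the left of $\Delta^n$, where $\Delta^n$ is the right $\Delta$-vector space of all $n\times 1$ column vectors. The semigroup $\mathcal{S}$ is called triangularizable if there is a chain of subspaces $\{0\} = \mathcal{V}_0 \subseteq \mathcal{V}_1 \subseteq \cdots \subseteq \mathcal{V}_n = \Delta^n$, where each $\mathcal{V}_j$ is a $j$-dimensional subspace invariant under every $S \in \mathcal{S}$. *)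

(* Defs.v *)
From mathcomp Require Import all_boot all_order all_algebra.
From mathcomp Require Import classical_sets functions cardinality.

Set Implicit Arguments.
Unset Strict Implicit.
Unset Printing Implicit Defensive.

Import GRing.Theory.
Local Open Scope classical_set_scope.
Local Open Scope ring_scope.

(* Commutativity of [D] is not part of [unitRingType], and [1 != 0] is. *)
Definition division_ring (D : unitRingType) : Prop :=
  forall x : D, x != 0 -> x \is a GRing.unit.

Definition central (D : unitRingType) (c : D) : Prop :=
  forall x : D, c * x = x * c.

Definition nilpotent_mx (D : unitRingType) (n : nat) (N : 'M[D]_n) : Prop :=
  exists k : nat, N ^+ k = 0.

Definition mx_semigroup (D : unitRingType) (n : nat) (S : set 'M[D]_n) : Prop :=
  forall A B : 'M[D]_n, S A -> S B -> S (A *m B).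

(* The library's [*:] on ['cV[D]_n] multiplies entries on the left; the column
   space here is a right vector space, so scalars act on the right. *)
Definition rscale (D : unitRingType) (n : nat) (v : 'cV[D]_n) (a : D) :
  'cV[D]_n := \col_i (v i ord0 * a).

Definition rsubspace (D : unitRingType) (n : nat) (V : set 'cV[D]_n) : Prop :=
  [/\ V 0,
      forall u v : 'cV[D]_n, V u -> V v -> V (u + v) &
      forall (v : 'cV[D]_n) (a : D), V v -> V (rscale v a)].

Definition rcomb (D : unitRingType) (n j : nat) (b : 'I_j -> 'cV[D]_n)
  (x : 'I_j -> D) : 'cV[D]_n := \sum_(k < j) rscale (b k) (x k).

Definition rfree (D : unitRingType) (n j : nat) (b : 'I_j -> 'cV[D]_n) : Prop :=
  forall x : 'I_j -> D, rcomb b x = 0 -> forall k : 'I_j, x k = 0.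

Definition rbasis (D : unitRingType) (n j : nat) (V : set 'cV[D]_n)
  (b : 'I_j -> 'cV[D]_n) : Prop := rfree b /\ V = range (rcomb b).

Definition has_rdim (D : unitRingType) (n : nat) (V : set 'cV[D]_n) (j : nat) :
  Prop := exists b : 'I_j -> 'cV[D]_n, rbasis V b.

Definition invariant (D : unitRingType) (n : nat) (S : set 'M[D]_n)
  (V : set 'cV[D]_n) : Prop :=
  forall (A : 'M[D]_n) (v : 'cV[D]_n), S A -> V v -> V (A *m v).

(* Only [V 0], ..., [V n] matter. *)
Definition triangularizable (D : unitRingType) (n : nat) (S : set 'M[D]_n) :
  Prop :=
  exists V : nat -> set 'cV[D]_n,
    [/\ V 0%N = [set 0],
        V n = setT,
        forall j : nat, (j < n)%N -> V j `<=` V j.+1 &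
        forall j : nat, (j <= n)%N ->
          [/\ rsubspace (V j), has_rdim (V j) j & invariant S (V j)]].

(* Main.v *)
Require Import Defs.
From mathcomp Require Import all_boot all_order all_algebra.
From mathcomp Require Import all_fingroup all_solvable.
From mathcomp Require Import boolp classical_sets functions cardinality.

Set Implicit Arguments.
Unset Strict Implicit.
Unset Printing Implicit Defensive.

Import GRing.Theory.
Local Open Scope classical_set_scope.
Local Open Scope ring_scope.

(** The semigroup may be enlarged by the identity, so let it contain [1]. A flag
    of invariant subspaces is built one dimension at a time: given a proper
    invariant subspace [W], it is enough to find a vector [v] outside [W] which
    every [A] in the semigroup maps into [v d + W] for some central [d], because
    then [W + v D] is again invariant. All the work is thus done modulo [W],
    without forming quotient spaces.

    Write [A = c + N] for a member of the semigroup, with [c] central and [N]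
    nilpotent. If [c] is nonzero then [A] is cancellable, hence has finite order
    by finiteness; if [c = 0] then [A] is nilpotent. The nilpotent members form
    an ideal, as a matrix with a right inverse is not nilpotent, and a product of
    sufficiently many of them vanishes: in an infinite sequence of products, each
    a left multiple of the preceding one, two terms agree, so some product is
    fixed by a nilpotent factor. Hence the subspace [U] of the vectors that all
    nilpotent members send into [W] is not contained in [W]
    ([nilpotent_annihilated]), and it is invariant. It remains to find [v] in [U]
    for the finite group [G] of the members with [c] nonzero.

    The group [G] is nilpotent, being a [p]-group modulo its centre. If [D] has
    characteristic zero, a matrix [c + N] of finite order is scalar
    ([nonscalar_finite_order_torsion]). If [p] is prime and [p = 0] in [D], then
    [(c + N) ^ (p ^ k) = c ^ (p ^ k)] as soon as [N ^ (p ^ k) = 0]. So in both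
    cases some [p ^ k]-th power of each element is scalar.

    For a finite nilpotent group [G] there is a common eigenvector modulo [W]
    ([nilpotent_group_eigenvector]), by an argument in the style of Engel's
    theorem. A maximal subgroup [Q] of [G] is normal, and by induction it has a
    common eigenvector outside [W]. Each [x] in [G] preserves the common
    eigenspace of [Q], because conjugate matrices have the same scalar [c]. Take
    [x] outside [Q], with scalar [c]; as [x - c] is nilpotent, the eigenspace
    contains a vector outside [W] that [x - c] sends into [W]. The elements of
    [G] for which this vector is an eigenvector form a subgroup that contains
    [Q] and [x], which is therefore [G]. *)

(** [c] is the scalar part of [A] in a decomposition of [A] into a central scalar
    plus a nilpotent matrix; by [eigen_unique], [A] has no other central
    eigenvalue. *)
Definition eigen (D : unitRingType) (n : nat) (A : 'M[D]_n) (c : D) : Prop :=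
  central c /\ nilpotent_mx (A - c%:M).

(** * Central scalars *)

Lemma central0 (D : unitRingType) : central (0 : D).
Proof. by move=> x; rewrite mul0r mulr0. Qed.

Lemma central1 (D : unitRingType) : central (1 : D).
Proof. by move=> x; rewrite mul1r mulr1. Qed.

Lemma centralB (D : unitRingType) (c d : D) :
  central c -> central d -> central (c - d).
Proof. by move=> hc hd x; rewrite mulrBl mulrBr hc hd. Qed.

Lemma centralM (D : unitRingType) (c d : D) :
  central c -> central d -> central (c * d).
Proof. by move=> hc hd x; rewrite -mulrA hd mulrA hc mulrA. Qed.

Lemma centralX (D : unitRingType) (c : D) k : central c -> central (c ^+ k).
Proof.
move=> hc; elim: k => [|k IHk]; first exact: central1.
by rewrite exprS; exact: centralM.
Qed.

Lemma centralV (D : unitRingType) (c : D) :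
  c \is a GRing.unit -> central c -> central c^-1.
Proof.
move=> uc hc x; apply: (mulrI uc); apply: (mulIr uc).
by rewrite mulrA divrr // mul1r mulrA -mulrA mulVr // mulr1 hc.
Qed.

Lemma central_scalar_mxC (D : unitRingType) m n (c : D) (A : 'M[D]_(m, n)) :
  central c -> A *m c%:M = c *: A.
Proof.
move=> hc; apply/matrixP=> i j; rewrite !mxE (bigD1 j) //= big1 => [|k nkj].
  by rewrite addr0 !mxE eqxx hc.
by rewrite !mxE (negbTE nkj) mulr0.
Qed.

Lemma central_scalemxAr (D : unitRingType) m n p (c : D)
    (A : 'M[D]_(m, n)) (B : 'M[D]_(n, p)) :
  central c -> A *m (c *: B) = c *: (A *m B).
Proof.
by move=> hc; rewrite -mul_scalar_mx mulmxA central_scalar_mxC // scalemxAl.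
Qed.

Lemma central_comm_mx (D : unitRingType) n (c : D) (A : 'M[D]_n) :
  central c -> GRing.comm A c%:M.
Proof.
by move=> hc; rewrite /GRing.comm -!mulmxE central_scalar_mxC // mul_scalar_mx.
Qed.

Lemma division_scaler_eq0 (D : unitRingType) m n (c : D) (A : 'M[D]_(m, n)) :
  division_ring D -> c *: A = 0 -> A != 0 -> c = 0.
Proof.
move=> hD cA0 nA0; apply/eqP; apply: contraNT nA0 => /hD uc.
by rewrite -[A]scale1r -(mulVr uc) -scalerA cA0 scaler0.
Qed.

Lemma division_mulf_eq0 (D : unitRingType) (x y : D) :
  division_ring D -> x * y = 0 -> x = 0 \/ y = 0.
Proof.
move=> hD xy0; have [->|/hD ux] := eqVneq x 0; [by left | right].
by rewrite -[y]mul1r -(mulVr ux) -mulrA xy0 mulr0.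
Qed.

(** * Eigenvalues modulo an invariant subspace *)

Lemma rsubspaceZ (D : unitRingType) n (W : set 'cV[D]_n) c v :
  rsubspace W -> central c -> W v -> W (c *: v).
Proof.
case=> _ _ WZ hc /(WZ v c); congr (W _).
by apply/matrixP=> i j; rewrite !mxE [j]ord1 hc.
Qed.

Lemma rsubspaceB (D : unitRingType) n (W : set 'cV[D]_n) u v :
  rsubspace W -> W u -> W v -> W (u - v).
Proof.
move=> hW Wu Wv; have [_ WD _] := hW.
rewrite -scaleN1r; apply: WD => //; apply: rsubspaceZ => //.
by rewrite -sub0r; apply: centralB; [exact: central0 | exact: central1].
Qed.

Lemma rsubspace_unitZ (D : unitRingType) n (W : set 'cV[D]_n) c v :
  rsubspace W -> central c -> c \is a GRing.unit -> W (c *: v) -> W v.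
Proof.
move=> hW hc uc /(rsubspaceZ hW (centralV uc hc)).
by rewrite scalerA mulVr // scale1r.
Qed.

(** On [v] modulo [W], the nilpotent matrix [A - c] acts as the scalar [d - c].
    Its powers act as those of [d - c], so [d - c] is nilpotent too, hence zero
    in a division ring. *)
Lemma eigen_unique (D : unitRingType) n (W : set 'cV[D]_n) (A : 'M[D]_n)
    (c d : D) (v : 'cV[D]_n) :
    division_ring D -> rsubspace W -> (forall u, W u -> W (A *m u)) ->
    ~ W v -> eigen A c -> central d -> W (A *m v - d *: v) ->
  c = d.
Proof.
move=> hD hW AW nWv [hc [k Bk0]] hd Wv; pose e := d - c.
have he : central e by exact: centralB.
have [W0 WD _] := hW.
have We m : W ((A - c%:M) ^+ m *m v - e ^+ m *: v).
  elim: m => [|m IHm]; first by rewrite !expr0 mul1mx scale1r subrr.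
  have -> : (A - c%:M) ^+ m.+1 *m v - e ^+ m.+1 *: v =
      (A - c%:M) *m ((A - c%:M) ^+ m *m v - e ^+ m *: v)
      + e ^+ m *: (A *m v - d *: v).
    rewrite exprS -mulmxE -mulmxA mulmxBr central_scalemxAr;
      last exact: centralX.
    rewrite -addrA; congr (_ + _).
    rewrite [RHS]addrC -scalerBr exprSr -scalerA -scalerN; congr (_ *: _).
    rewrite mulmxBl mul_scalar_mx /e scalerBl !opprB.
    by rewrite [RHS]addrC addrA subrK.
  apply: WD; last by apply: rsubspaceZ => //; exact: centralX.
  rewrite mulmxBl mul_scalar_mx; apply: rsubspaceB => //; first exact: AW.
  exact: rsubspaceZ.
apply/esym/eqP; rewrite -subr_eq0; apply/negP => /negP /hD ue.
have := We k; rewrite Bk0 mul0mx sub0r -scalerN => Wk.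
have : W (- v).
  by apply: rsubspace_unitZ Wk => //; [exact: centralX | exact: unitrX].
by move=> /(rsubspaceB hW W0); rewrite sub0r opprK.
Qed.

Lemma rsubspace0 (D : unitRingType) n : rsubspace [set (0 : 'cV[D]_n)].
Proof.
split=> [//|u v /= -> ->|v a /= ->]; first by rewrite addr0.
by apply/matrixP=> i j; rewrite !mxE mul0r.
Qed.

Lemma eigen_conj (D : unitRingType) n (A X Y : 'M[D]_n) c :
  X * Y = 1 -> Y * X = 1 -> eigen A c -> eigen (X * A * Y) c.
Proof.
move=> XY YX [hc [k Ak]]; split=> //; exists k.
have -> : X * A * Y - c%:M = X * (A - c%:M) * Y.
  rewrite mulrBr mulrBl; congr (_ - _).
  by rewrite (central_comm_mx X hc) -mulrA XY mulr1.
suff -> : (X * (A - c%:M) * Y) ^+ k = X * (A - c%:M) ^+ k * Y.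
  by rewrite Ak mulr0 mul0r.
elim: k {Ak} => [|k IHk]; first by rewrite !expr0 mulr1.
by rewrite !exprS IHk !mulrA -(mulrA _ Y X) YX mulr1.
Qed.

(** * Common eigenvectors of nilpotent groups *)

(** The iterates of [v] under [B] end in zero, so one of those outside [W] is
    followed by one in [W]; it is the required vector. *)
Lemma nilpotent_escape (D : unitRingType) n (U W : set 'cV[D]_n)
    (B : 'M[D]_n) (v : 'cV[D]_n) :
  W 0 -> nilpotent_mx B -> (forall u, U u -> U (B *m u)) -> U v -> ~ W v ->
  exists u, [/\ U u, ~ W u & W (B *m u)].
Proof.
move=> W0 [k Bk] BU Uv nWv; apply: contrapT => nex.
have H m : U (B ^+ m *m v) /\ ~ W (B ^+ m *m v).
  elim: m => [|m [IHU IHW]]; first by rewrite expr0 mul1mx.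
  rewrite exprS -mulmxE -mulmxA; split; first exact: BU.
  by move=> WB; apply: nex; exists (B ^+ m *m v).
by case: (H k) => _; rewrite Bk mul0mx.
Qed.

(** A simultaneous eigenvector modulo [W], found by induction on the order of the
    group, adding to a maximal subgroup [Q] one element outside [Q]. *)
Lemma nilpotent_group_eigenvector (D : unitRingType) (n : nat)
    (gT : finGroupType) (G : {group gT}) (r : gT -> 'M[D]_n)
    (U W : set 'cV[D]_n) :
    division_ring D -> nilpotent G ->
    r 1%g = 1 -> {in G &, {morph r : x y / (x * y)%g >-> x * y}} ->
    (forall x, x \in G -> exists c, eigen (r x) c) ->
    rsubspace U -> rsubspace W ->
    (forall x u, x \in G -> U u -> U (r x *m u)) ->
    (forall x u, x \in G -> W u -> W (r x *m u)) ->
    (exists2 u, U u & ~ W u) ->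
  exists v, [/\ U v, ~ W v &
    forall x, x \in G -> exists2 d, central d & W (r x *m v - d *: v)].
Proof.
move=> hD + r1 + + hU hW.
elim: {G}#|G|.+1 {-2}G (ltnSn #|G|) => // m IHm G leGm nilG rM reig GU GW exu.
have [W0 WD _] := hW.
have [eG|[Q maxQ _]] := maximal_exists (sub1G G).
  case: exu => u Uu nWu; exists u; split=> // x.
  rewrite -eG => /finset.set1P ->; exists 1; first exact: central1.
  by rewrite r1 mul1mx scale1r subrr.
have /maxgroupP[prQG maxQG] := maxQ.
have sQG := proper_sub prQG; have sQGP := fintype.subsetP sQG.
(* A maximal subgroup of a nilpotent group is normal, since it is properly
   contained in its normaliser. *)
have nQG : G \subset 'N(Q)%g.
  have /eqVproper[eNQ|] : 'N_G(Q)%g \subset G by exact: subsetIl.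
    by rewrite -{1}eNQ subsetIr.
  move=> /maxQG/(_ (proper_sub (nilpotent_proper_norm nilG prQG))) eNQ.
  by have := nilpotent_proper_norm nilG prQG; rewrite {}eNQ fintype.properxx.
have rV x : x \in G -> r x * r x^-1%g = 1.
  by move=> Gx; rewrite -rM ?groupV // mulgV r1.
have [v0 [Uv0 nWv0 Qv0]] : exists v, [/\ U v, ~ W v &
    forall x, x \in Q -> exists2 d, central d & W (r x *m v - d *: v)].
  apply: IHm => //.
  - exact: leq_trans (proper_card prQG) _.
  - exact: nilpotentS nilG.
  - by move=> x y /sQGP Gx /sQGP Gy; exact: rM.
  - by move=> x /sQGP; exact: reig.
  - by move=> x u /sQGP; exact: GU.
  - by move=> x u /sQGP; exact: GW.
have /properP[_ [x Gx nQx]] := prQG.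
have [c hc] := reig x Gx; have [cc nilB] := hc.
(* Requiring the eigenvalue of [r y] to be its scalar part makes [E] stable under
   conjugation of [y]; by [eigen_unique] it excludes no common eigenvector
   outside [W]. *)
pose E : set 'cV[D]_n := [set u | U u /\
  forall y d, y \in Q -> eigen (r y) d -> W (r y *m u - d *: u)].
have xE u : E u -> E (r x *m u).
  move=> [Uu Qu]; split; first exact: GU.
  move=> y d Qy hd; have Gy := sQGP _ Qy.
  have Qyx : (y ^ x)%g \in Q by rewrite memJ_norm // (fintype.subsetP nQG).
  have hdx : eigen (r (y ^ x)%g) d.
    have -> : r (y ^ x)%g = r x^-1%g * r y * r x.
      by rewrite conjgE mulgA !rM ?groupM ?groupV.
    apply: eigen_conj => //; last exact: rV.
    by rewrite -{2}[x]invgK; apply: rV; rewrite groupV.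
  have := GW x _ Gx (Qu _ _ Qyx hdx); congr (W _).
  rewrite mulmxBr !mulmxA central_scalemxAr; last by case: hd.
  by rewrite !mulmxE -!rM ?groupJ // [(y * x)%g]conjgC.
(* [x] and hence the nilpotent matrix [r x - c] act on [E]. *)
have [v [[Uv Qv] nWv Bv]] : exists v, [/\ E v, ~ W v & W ((r x - c%:M) *m v)].
  apply: (@nilpotent_escape D n E W _ v0) => //.
  - move=> u Eu; have [Uxu Exu] := xE u Eu; have [Uu Equ] := Eu.
    rewrite mulmxBl mul_scalar_mx; split.
      by apply: rsubspaceB => //; exact: rsubspaceZ.
    move=> y d Qy hd; have := rsubspaceB hW (Exu y d Qy hd)
      (rsubspaceZ hW cc (Equ y d Qy hd)).
    congr (W _); rewrite mulmxBr central_scalemxAr // !scalerBr !scalerA -cc.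
    by rewrite !opprB addrACA [RHS]addrACA; congr (_ + _); rewrite addrC.
  - split=> // y d Qy hd; have [d' cd' Wd'] := Qv0 y Qy.
    have -> // : d = d'.
    by apply: (eigen_unique hD hW _ nWv0 hd cd' Wd') => u; exact/GW/sQGP.
(* The elements of [G] having [v] as an eigenvector modulo [W] form a subgroup
   strictly larger than [Q], so all of [G] by maximality. *)
pose T := [set y in G | `[< exists2 d, central d & W (r y *m v - d *: v) >]].
have groupT : group_set T.
  apply/group_setP; split.
    rewrite inE group1; apply/asboolP; exists 1; first exact: central1.
    by rewrite r1 mul1mx scale1r subrr.
  move=> y z; rewrite !inE => /andP[Gy /asboolP[d cd Wd]].
  move=> /andP[Gz /asboolP[e ce We]].
  rewrite groupM //; apply/asboolP; exists (e * d); first exact: centralM.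
  have := WD _ _ (GW y _ Gy We) (rsubspaceZ hW ce Wd); congr (W _).
  rewrite mulmxBr central_scalemxAr // scalerBr scalerA mulmxA rM // mulmxE.
  by rewrite addrA subrK.
have QT : Q \proper Group groupT.
  apply/properP; split.
    apply/fintype.subsetP=> y Qy; rewrite inE (sQGP _ Qy); apply/asboolP.
    have [d hd] := reig y (sQGP _ Qy); exists d; first by case: hd.
    exact: Qv.
  exists x => //; rewrite inE Gx; apply/asboolP; exists c => //.
  by rewrite mulmxBl mul_scalar_mx in Bv.
exists v; split=> // y Gy.
have : y \in T; last by rewrite inE => /andP[_ /asboolP].
apply/negP=> /negP nTy.
have := maxQG (Group groupT).
have -> : Group groupT \proper G.
  apply/properP; split; last by exists y.
  by apply/fintype.subsetP=> z; rewrite inE => /andP[].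
move=> /(_ isT (proper_sub QT)) eTQ.
by move: QT; rewrite eTQ fintype.properxx.
Qed.

(** * Finite semigroups of matrices *)

Lemma finite_repeat (T : eqType) (S : set T) (f : nat -> T) :
  finite_set S -> (forall i, S (f i)) -> exists i j, (i < j)%N /\ f i = f j.
Proof.
move=> /finite_seqP[s eS] Sf; apply: contrapT => nrep.
suff /uniq_leq_size : uniq (map f (iota 0 (size s).+1)).
  move=> /(_ s); rewrite size_map size_iota ltnn => Hs.
  apply: notF; apply: Hs => _ /mapP[i _ ->].
  by have := Sf i; rewrite eS.
rewrite map_inj_uniq ?iota_uniq // => i j fij.
by case: (ltngtP i j) => // [ij|ji]; case: nrep; [exists i, j | exists j, i].
Qed.

Lemma semigroupX (D : unitRingType) n (S : set 'M[D]_n) A k :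
  mx_semigroup S -> S A -> S (A ^+ k.+1).
Proof.
move=> hS SA; elim: k => [|k IHk]; first by rewrite expr1.
by rewrite exprS; exact: hS.
Qed.

(** A nonzero column of [B] would be an eigenvector of [A] for the eigenvalue
    zero. *)
Lemma eigen_lreg (D : unitRingType) n (A B : 'M[D]_n) c :
  division_ring D -> eigen A c -> c != 0 -> A * B = 0 -> B = 0.
Proof.
move=> hD hc nc0 AB0; apply/matrixP=> i j; rewrite mxE; apply: contrapT => nBij.
suff c0 : c = 0 by rewrite c0 eqxx in nc0.
apply: (@eigen_unique D n [set 0] A c 0 (col j B) hD) => //.
- exact: rsubspace0.
- by move=> u /= ->; rewrite mulmx0.
- by move=> /= /matrixP/(_ i ord0); rewrite !mxE.
- exact: central0.
- by rewrite /= scale0r subr0 colE mulmxA mulmxE AB0 mul0mx.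
Qed.

(** Two powers of [A] agree, and powers of [A] can be cancelled. *)
Lemma finite_order (D : unitRingType) n (S : set 'M[D]_n) A c :
    division_ring D -> mx_semigroup S -> finite_set S -> S A ->
    eigen A c -> c != 0 ->
  exists m, A ^+ m.+1 = 1.
Proof.
move=> hD hS fS SA hc nc0.
have [i [j [ij eA]]] := finite_repeat fS (fun k => semigroupX k hS SA).
exists (j - i.+1)%N; apply/eqP; rewrite -subr_eq0; apply/eqP.
have cancel k : A ^+ k * (A ^+ (j - i.+1).+1 - 1) = 0 ->
    A ^+ (j - i.+1).+1 - 1 = 0.
  elim: k => [|k IHk]; first by rewrite expr0 mul1r.
  by rewrite exprS -mulrA => /(eigen_lreg hD hc nc0).
apply: (cancel i.+1); rewrite mulrBr mulr1 -exprD.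
by rewrite -subSn // subnKC ?ltnS 1?ltnW // eA subrr.
Qed.

Lemma nilpotent_right_inverse (D : unitRingType) n (A X : 'M[D]_n) :
  (0 < n)%N -> nilpotent_mx A -> A * X <> 1.
Proof.
case: n A X => [//|n] A X _ [k Ak] AX.
have : A ^+ k * X ^+ k = 1.
  elim: k {Ak} => [|k IHk]; first by rewrite !expr0 mulr1.
  by rewrite exprSr exprS mulrA -(mulrA _ A) AX mulr1.
by rewrite Ak mul0r => /esym/eqP; rewrite oner_eq0.
Qed.

Lemma nilpotent_or_eigen_neq0 (D : unitRingType) n (A : 'M[D]_n) :
  (exists c, eigen A c) ->
  nilpotent_mx A \/ exists2 c, c != 0 & eigen A c.
Proof.
case=> c hc; have [c0|nc0] := eqVneq c 0; last by right; exists c.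
by left; case: hc => _; rewrite c0 raddf0 subr0.
Qed.

(** Otherwise [A * B] has finite order, which provides a right inverse of [A]. *)
Lemma nilpotent_right_ideal (D : unitRingType) n (S : set 'M[D]_n) A B :
    division_ring D -> (0 < n)%N -> mx_semigroup S -> finite_set S ->
    (forall A, S A -> exists c, eigen A c) ->
    S A -> S B -> nilpotent_mx A ->
  nilpotent_mx (A * B).
Proof.
move=> hD n0 hS fS eS SA SB nilA.
have SAB : S (A * B) by exact: hS.
have [//|[c nc0 hc]] := nilpotent_or_eigen_neq0 (eS _ SAB).
have [m] := finite_order hD hS fS SAB hc nc0.
by rewrite exprS -mulrA => /(nilpotent_right_inverse n0 nilA).
Qed.

(** If the conclusion failed, one could choose nilpotent members [A_0], [A_1], ...
    such that no product [B_i = A_(i-1) ... A_0] sends [v] into [W]. By finiteness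
    [B_i = B_j] for some [i < j], so that [B_i = A B_i] with [A] nilpotent, and
    [B_i = A ^ k B_i = 0] for large [k]. *)
Lemma nilpotent_annihilated (D : unitRingType) n (S : set 'M[D]_n)
    (W : set 'cV[D]_n) (v : 'cV[D]_n) :
    division_ring D -> (0 < n)%N -> mx_semigroup S -> finite_set S -> S 1 ->
    (forall A, S A -> exists c, eigen A c) ->
    W 0 -> ~ W v ->
  exists2 u, ~ W u & forall A, S A -> nilpotent_mx A -> W (A *m u).
Proof.
move=> hD n0 hS fS S1 eS W0 nWv; apply: contrapT => nex.
have next u : ~ W u -> exists A, [/\ S A, nilpotent_mx A & ~ W (A *m u)].
  move=> nWu; apply: contrapT => nA; apply: nex; exists u => // A SA nilA.
  by apply: contrapT => nWA; apply: nA; exists A.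
pose X := {B | S B /\ ~ W (B *m v)}.
pose R (x y : X) :=
  exists A, [/\ S A, nilpotent_mx A & sval y = A * sval x].
have stepR (x : X) : {y | R x y}.
  apply: cid; case: x => B [SB nWB]; have [A [SA nilA nWA]] := next _ nWB.
  have AB : S (A * B) /\ ~ W ((A * B) *m v).
    by rewrite -mulmxE -mulmxA; split; [exact: hS|].
  by exists (exist _ (A * B) AB), A.
have I : S 1 /\ ~ W (1 *m v) by rewrite mul1mx.
have [f [_ fR]] := dependent_choice stepR (exist _ 1 I).
have fA i j : (i < j)%N ->
    exists A, [/\ S A, nilpotent_mx A & sval (f j) = A * sval (f i)].
  elim: j => // j IHj; rewrite ltnS leq_eqVlt => /predU1P[->|/IHj]; first exact: fR.
  move=> [A [SA nilA eA]]; have [B [SB nilB ->]] := fR j; rewrite {}eA.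
  exists (B * A); split; [exact: hS | | by rewrite mulrA].
  exact: (nilpotent_right_ideal hD n0 hS fS eS).
have [i [j [ij efij]]] :=
  finite_repeat fS (fun k => proj1 (proj2_sig (f k))).
have [A [SA [k Ak]]] := fA i j ij; rewrite -efij => eA.
have [_] := proj2_sig (f i); apply.
suff -> : sval (f i) = 0 by rewrite mul0mx.
have {}eA m : sval (f i) = A ^+ m * sval (f i).
  elim: m => [|m IHm]; first by rewrite expr0 mul1r.
  by rewrite exprSr -mulrA -eA.
by rewrite (eA k) Ak mul0r.
Qed.

(** * The invertible elements form a nilpotent group *)

(** The additive order of [1] is prime, since [D] has no zero divisors. *)
Lemma torsion_prime (D : unitRingType) m :
  division_ring D -> (m.+1)%:R = 0 :> D -> exists2 p, prime p & p%:R = 0 :> D.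
Proof.
move=> hD Dm0.
have exm : exists m, ((m.+1)%:R == 0 :> D) by exists m; apply/eqP.
case: (ex_minnP exm) => p /eqP p0 minp; exists p.+1 => //.
have p_gt0 : (0 < p)%N.
  by rewrite lt0n; apply: contra_eqN p0 => /eqP ->; rewrite oner_eq0.
apply/primeP; split=> // d /dvdnP[e ep].
have [d0|d0] := posnP d; first by rewrite d0 muln0 in ep.
have [e0|e0] := posnP e; first by rewrite e0 in ep.
have : e%:R * d%:R = 0 :> D by rewrite -natrM -ep.
have large q : (0 < q)%N -> q%:R = 0 :> D -> (p.+1 <= q)%N.
  by case: q => // q _ /eqP; exact: minp.
case/(division_mulf_eq0 hD) => [/(large _ e0) pe|/(large _ d0) pd].
  by rewrite ep -{2}(muln1 e) leq_pmul2l // in pe; rewrite eqn_leq pe d0.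
by rewrite orbC eqn_leq pd ep leq_pmull.
Qed.

(** Frobenius is additive on commuting elements of a ring of characteristic
    [p]. *)
Lemma exprD_prime_power_comm (R : pzRingType) (x y : R) p k :
  prime p -> p%:R = 0 :> R -> GRing.comm x y ->
  (x + y) ^+ (p ^ k) = x ^+ (p ^ k) + y ^+ (p ^ k).
Proof.
move=> pr_p p0 cxy; elim: k => [|k IHk]; first by rewrite expn0 !expr1.
rewrite expnSr !exprM IHk; set u := x ^+ _; set v := y ^+ _.
have cuv : GRing.comm u v by apply: commrX; apply/commr_sym/commrX/commr_sym.
move: u v cuv {IHk} => u v /exprDn_comm ->; case: p pr_p p0 => // p pr_p p0.
rewrite big_ord_recl big_ord_recr /= subn0 subnn !expr0 mulr1 mul1r.
rewrite bin0 binn !mulr1n big1 ?add0r // => i _.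
have /dvdnP[q ->] : (p.+1 %| 'C(p.+1, bump 0 i))%N.
  by apply: prime_dvd_bin => //; rewrite /bump /= add1n ltnS ltn_ord.
by rewrite mulrnA -mulr_natr p0 mulr0.
Qed.

(** With [N = A - c] and [X] the last power of [N] such that [N X] is nonzero, the
    binomial expansion of [A ^ i X] stops after its linear term:
    [A ^ i X = c ^ i X + i c ^ (i - 1) N X]. If [A ^ m = 1], multiplying by [N]
    gives [c ^ m = 1], and the linear term must vanish. *)
Lemma nonscalar_finite_order_torsion (D : unitRingType) n (A : 'M[D]_n) c m :
  division_ring D -> eigen A c -> A ^+ m.+1 = 1 -> A != c%:M ->
  (m.+1)%:R = 0 :> D.
Proof.
move=> hD [cc nilN] Am nAc; pose N := A - c%:M.
have exk : exists k, N ^+ k == 0 by case: nilN => k Nk; exists k; apply/eqP.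
have nN0 : N != 0 by rewrite subr_eq0.
have eAN : A = c%:M + N by rewrite addrC subrK.
clearbody N.
case: (ex_minnP exk) => -[|[|k]] Nk mink.
- by case/eqP: nN0; rewrite -[N]mulr1 -(expr0 N) (eqP Nk) mulr0.
- by case/eqP: nN0; rewrite -[N]expr1 (eqP Nk).
pose X := N ^+ k.
have nNX : N *m X != 0.
  by rewrite mulmxE -exprS; apply/negP => /mink; rewrite ltnn.
have NNX : N *m (N *m X) = 0 by rewrite !mulmxE -!exprS; apply/eqP.
have AX i : A ^+ i *m X = c ^+ i *: X + (i%:R * c ^+ i.-1) *: (N *m X).
  elim: i => [|i IHi].
    by rewrite !expr0 mul1mx scale1r mul0r scale0r addr0.
  have cX j : central (i%:R * c ^+ j).
    apply: centralM (centralX _ cc) => x.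
    by rewrite mulr_natl mulr_natr.
  rewrite exprS -mulmxE -mulmxA IHi {1}eAN mulmxDr !central_scalemxAr //;
    last exact: centralX.
  rewrite !mulmxDl !mul_scalar_mx NNX addr0 scalerDr !scalerA.
  rewrite -exprSr -addrA -scalerDl; congr (_ + _ *: _).
  case: i {IHi cX} => [|i] /=; first by rewrite mulr0n !mul0r addr0 !expr0 mulr1.
  by rewrite -[i.+2%:R]natr1 mulrDl mul1r -mulrA -exprSr addrC.
have NA : N *m (A ^+ m.+1 *m X) = c ^+ m.+1 *: (N *m X).
  rewrite AX mulmxDr !central_scalemxAr ?NNX ?scaler0 ?addr0 //.
    apply: centralM (centralX _ cc) => x.
    by rewrite mulr_natl mulr_natr.
  exact: centralX.
have cm1 : c ^+ m.+1 = 1.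
  apply/eqP; rewrite -subr_eq0; apply/eqP.
  apply: division_scaler_eq0 hD _ nNX.
  by rewrite scalerBl -NA Am mul1mx scale1r subrr.
have := AX m.+1; rewrite Am cm1 mul1mx scale1r -{1}[X]addr0 => /addrI/esym E.
case: (division_mulf_eq0 hD (division_scaler_eq0 hD E nNX)) => //= cm0.
by have := cm1; rewrite exprS cm0 mulr0 => /esym/eqP; rewrite oner_eq0.
Qed.

(** In characteristic zero every matrix concerned is already scalar, so any prime
    will do, with [k = 0]; in characteristic [p] the nilpotent part is killed by
    the iterated Frobenius. *)
Lemma scalar_prime_power (D : unitRingType) (n : nat) : division_ring D ->
  exists2 p, prime p & forall (A : 'M[D]_n) c m,
    eigen A c -> A ^+ m.+1 = 1 ->
    exists k d, central d /\ A ^+ (p ^ k) = d%:M.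
Proof.
move=> hD.
have [[m /(torsion_prime hD)[p pr_p p0]]|char0] :=
    pselect (exists m, (m.+1)%:R = 0 :> D); last first.
  exists 2 => // A c m hc Am; exists 0%N, c; split; first by case: hc.
  rewrite expr1; apply/eqP/negPn/negP => nAc.
  by apply: char0; exists m; exact: nonscalar_finite_order_torsion hc Am nAc.
exists p => // A c _ [cc [k Nk]] _; exists k, (c ^+ (p ^ k)).
split; first exact: centralX.
have p0M : p%:R = 0 :> 'M[D]_n.
  by rewrite -(rmorph_nat (@scalar_mx D n)) p0 raddf0.
rewrite -{1}[A](subrK c%:M) exprD_prime_power_comm //; last exact: central_comm_mx.
(* [N ^ k = 0] and [k <= p ^ k]. *)
rewrite -(subnK (ltnW (ltn_expl k (prime_gt1 pr_p)))) exprD Nk mulr0 add0r.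
by rewrite -rmorphXn.
Qed.

(** By Cauchy's theorem, the quotient by the centre is a [p]-group. *)
Lemma center_exponent_nilpotent (gT : finGroupType) (G : {group gT}) p :
  prime p -> (forall x, x \in G -> exists k, (x ^+ (p ^ k))%g \in 'Z(G)%g) ->
  nilpotent G.
Proof.
move=> pr_p ZG; rewrite -quotient_center_nil; apply: (@pgroup_nil _ p).
apply/pgroupP => q pr_q /(Cauchy pr_q)[_ /morphimP[x Nx Gx ->] ox].
have [k Zxk] := ZG x Gx.
have : (q %| p ^ k)%N by rewrite -ox order_dvdn -morphX //; apply/eqP/coset_id.
by rewrite Euclid_dvdX // dvdn_prime2 // => /andP[].
Qed.

(** A finite semigroup of matrices of finite order is a group. To apply the theory
    of finite groups, it is represented by the permutations of its underlying set
    that are right multiplications; the matrix of such a permutation is its value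
    at the identity matrix. *)
Lemma matrix_group_eigenvector (D : unitRingType) n (S : set 'M[D]_n)
    (U W : set 'cV[D]_n) :
    division_ring D -> mx_semigroup S -> finite_set S -> S 1 ->
    (forall A, S A -> exists2 c, c != 0 & eigen A c) ->
    rsubspace U -> rsubspace W -> Defs.invariant S U -> Defs.invariant S W ->
    (exists2 u, U u & ~ W u) ->
  exists v, [/\ U v, ~ W v &
    forall A, S A -> exists2 d, central d & W (A *m v - d *: v)].
Proof.
move=> hD hS fS S1 eS hU hW SU SW exu.
have /finite_seqP[s es] := fS.
have inS A : S A <-> A \in s by rewrite es.
pose T := seq_sub s; pose e : T := SeqSub (proj1 (inS 1) S1).
have ST (B : T) : S (val B) by apply/inS/valP.
pose r (x : {perm T}) : 'M[D]_n := val (x e).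
pose Gs := [set x : {perm T} | [forall B, val (x B) == val B * r x]]%SET.
have GsP x B : x \in Gs -> val (x B) = val B * r x.
  by rewrite inE => /forallP/(_ B)/eqP.
have rM : {in Gs &, {morph r : x y / (x * y)%g >-> x * y}}.
  by move=> x y Gx Gy; rewrite /r permM GsP.
have r1 : r 1%g = 1 by rewrite /r perm1.
have groupG : group_set Gs.
  apply/group_setP; split=> [|x y Gx Gy].
    by rewrite inE; apply/forallP => B; rewrite r1 mulr1 perm1.
  by rewrite inE; apply/forallP => B; rewrite permM rM // !GsP // mulrA.
pose G := Group groupG.
have rinj x y : x \in G -> y \in G -> r x = r y -> x = y.
  by move=> Gx Gy exy; apply/permP => B; apply: val_inj; rewrite !GsP // exy.
have rX x k : x \in G -> r (x ^+ k)%g = r x ^+ k.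
  move=> Gx; elim: k => [|k IHk]; first by rewrite r1.
  by rewrite expgS exprS -IHk; apply: rM => //; exact: (groupX k Gx).
have rG A : S A -> exists2 x, x \in G & r x = A.
  move=> SA; have [c nc0 hc] := eS A SA.
  have [m Am] := finite_order hD hS fS SA hc nc0.
  pose f (B : T) : T := SeqSub (proj1 (inS _) (hS _ _ (ST B) SA)).
  have finj : injective f.
    move=> B C /(congr1 val) /= eBC; apply: val_inj => /=.
    rewrite mulmxE in eBC.
    by rewrite -[LHS]mulr1 -[RHS]mulr1 -Am exprS !mulrA eBC.
  exists (perm finj); last by rewrite /r permE /= mul1mx.
  by rewrite inE; apply/forallP => B; rewrite /r !permE /= mul1mx.
have nilG : nilpotent G.
  have [p pr_p sc] := scalar_prime_power n hD.
  apply: (center_exponent_nilpotent pr_p) => x Gx.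
  have [c nc0 hc] := eS _ (ST (x e)).
  have [m Am] := finite_order hD hS fS (ST (x e)) hc nc0.
  have [k [d [cd xk]]] := sc _ _ _ hc Am; exists k.
  apply/centerP; split=> [|y Gy]; first exact: groupX.
  have Gxk : (x ^+ (p ^ k))%g \in G by exact: groupX.
  apply: rinj; rewrite ?groupM // (rM _ _ Gxk Gy) (rM _ _ Gy Gxk) rX // xk.
  by rewrite (central_comm_mx (r y) cd).
have [v [Uv nWv Gv]] := @nilpotent_group_eigenvector D n _ G r U W hD nilG r1 rM
  (fun x _ => let: ex_intro2 c _ hc := eS _ (ST (x e)) in ex_intro _ c hc) hU hW
  (fun x u _ => SU _ u (ST (x e))) (fun x u _ => SW _ u (ST (x e))) exu.
exists v; split=> // A /rG[x Gx <-]; exact: Gv.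
Qed.

(** Modulo [W], every vector of the subspace [U] annihilated by the nilpotent
    members is an eigenvector of them, so only the members with a nonzero scalar
    part have to be dealt with, and they form a group acting on [U]. *)
Lemma semigroup_eigenvector (D : unitRingType) n (S : set 'M[D]_n)
    (W : set 'cV[D]_n) :
    division_ring D -> (0 < n)%N -> mx_semigroup S -> finite_set S -> S 1 ->
    (forall A, S A -> exists c, eigen A c) ->
    rsubspace W -> Defs.invariant S W -> (exists u, ~ W u) ->
  exists2 v, ~ W v &
    forall A, S A -> exists2 d, central d & W (A *m v - d *: v).
Proof.
move=> hD n0 hS fS S1 eS hW SW [u nWu]; have [W0 WD WZ] := hW.
have [u0 nWu0 Uu0] := nilpotent_annihilated hD n0 hS fS S1 eS W0 nWu.
pose U := [set v : 'cV[D]_n | forall A, S A -> nilpotent_mx A -> W (A *m v)].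
have hU : rsubspace U.
  split=> [A _ _|v w Uv Uw A SA nilA|v a Uv A SA nilA].
  - by rewrite mulmx0.
  - by rewrite mulmxDr; apply: WD; [exact: Uv | exact: Uw].
  - have -> : A *m rscale v a = rscale (A *m v) a; last by apply/WZ/Uv.
    apply/matrixP=> i j; rewrite !mxE mulr_suml; apply: eq_bigr => k _.
    by rewrite !mxE mulrA.
have SU : Defs.invariant S U.
  move=> A v SA Uv B SB nilB; rewrite mulmxA; apply: Uv; first exact: hS.
  exact: (nilpotent_right_ideal hD n0 hS fS eS).
pose S' := [set A | S A /\ exists2 c, c != 0 & eigen A c].
have S'S : S' `<=` S by move=> A [].
have hS' : mx_semigroup S'.
  move=> A B [SA [a na ha]] [SB [b nb hb]]; have SAB := hS _ _ SA SB.
  split=> //.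
  have [nilAB|//] := nilpotent_or_eigen_neq0 (eS _ SAB).
  have [i Ai] := finite_order hD hS fS SA ha na.
  have [j Bj] := finite_order hD hS fS SB hb nb.
  case: (@nilpotent_right_inverse _ _ _ (B ^+ j * A ^+ i) n0 nilAB).
  by rewrite mulmxE mulrA -(mulrA A) -exprS Bj mulr1 -exprS.
have S'1 : S' 1.
  split=> //; exists 1; first exact: oner_neq0.
  by split; [exact: central1 | exists 1%N; rewrite expr1 subrr].
have [v [Uv nWv S'v]] : exists v, [/\ U v, ~ W v &
    forall A, S' A -> exists2 d, central d & W (A *m v - d *: v)].
  apply: matrix_group_eigenvector => //.
  - exact: sub_finite_set fS.
  - by move=> A [].
  - by move=> A w /S'S; exact: SU.
  - by move=> A w /S'S; exact: SW.
  - by exists u0.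
exists v => // A SA.
have [nilA|exc] := nilpotent_or_eigen_neq0 (eS _ SA); last exact: S'v.
by exists 0; [exact: central0 | rewrite scale0r subr0; exact: Uv].
Qed.

(** * Dimension over a division ring *)

(** Gaussian elimination: a nonzero entry of the top row, in column [k], serves to
    eliminate the unknown [x_k] from the other equations. *)
Lemma wide_kernel (D : unitRingType) n m (M : 'M[D]_(n, m)) :
  division_ring D -> (n < m)%N -> exists2 x : 'cV[D]_m, x != 0 & M *m x = 0.
Proof.
move=> hD; elim: n m M => [|n IHn] [//|m] M nm.
  exists (const_mx 1); last by rewrite [LHS]flatmx0.
  by apply/eqP=> /matrixP/(_ ord0 ord0)/eqP; rewrite !mxE oner_eq0.
have [row0|[k Mk]] : (forall l, M ord0 l = 0) \/ exists k, M ord0 k != 0.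
  apply: contrapT => nor; apply: (nor); left => l; apply/eqP/negPn/negP => Ml.
  by apply: nor; right; exists l.
  have [x nx0 Mx] := IHn m.+1 (row' ord0 M) (ltnW nm); exists x => //.
  apply/matrixP=> i j; rewrite !mxE; case: (unliftP ord0 i) => [i' ->|->].
    have := congr1 (fun A : 'cV_n => A i' j) Mx; rewrite !mxE => Mxi.
    by rewrite -[RHS]Mxi; apply: eq_bigr => l _; rewrite !mxE.
  by rewrite big1 // => l _; rewrite row0 mul0r.
have uk := hD _ Mk; pose u := (M ord0 k)^-1.
have [y ny0 My] := IHn m (\matrix_(i, l) (M (lift ord0 i) (lift k l)
  - M (lift ord0 i) k * u * M ord0 (lift k l))) nm.
pose s := \sum_l M ord0 (lift k l) * y l ord0.
pose x : 'cV[D]_m.+1 :=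
  \col_l oapp (fun l' => y l' ord0) (- (u * s)) (unlift k l).
have xl l : x (lift k l) ord0 = y l ord0 by rewrite mxE liftK.
have xk : x k ord0 = - (u * s) by rewrite mxE unlift_none.
(* [x_k] is the value that solves the equation of the top row. *)
have Mx i : (M *m x) i ord0 =
    - (M i k * u * s) + \sum_l M i (lift k l) * y l ord0.
  rewrite mxE (bigD1_ord k) //= xk mulrN mulrA; congr (_ + _).
  by apply: eq_bigr => l _; rewrite xl.
exists x.
  apply: contraNneq ny0 => x0; apply/eqP/matrixP => l j.
  by rewrite [j]ord1 -xl x0 !mxE.
apply/matrixP => i j; rewrite [j]ord1 Mx mxE.
case: (unliftP ord0 i) => [i' ->|->]; last by rewrite mulrV // mul1r addNr.
have := congr1 (fun A : 'cV_n => A i' ord0) My; rewrite !mxE => Myi.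
rewrite -[RHS]Myi /s mulr_sumr addrC -sumrB; apply: eq_bigr => l _.
by rewrite !mxE mulrBl !mulrA.
Qed.

(** A single sequence of vectors provides the bases of all members of the flag,
    by restriction to initial segments. *)
Definition first_vectors (D : unitRingType) n (b : nat -> 'cV[D]_n) (j : nat)
  : 'I_j -> 'cV[D]_n := fun k => b k.

Definition rspan (D : unitRingType) n (b : nat -> 'cV[D]_n) (j : nat) :
  set 'cV[D]_n := range (rcomb (first_vectors b (j := j))).

Lemma rcomb_mulmx (D : unitRingType) n j (b : 'I_j -> 'cV[D]_n) (x : 'I_j -> D) :
  rcomb b x = (\matrix_(i, k) b k i ord0) *m (\col_k x k).
Proof.
apply/matrixP => i l; rewrite summxE mxE; apply: eq_bigr => k _.
by rewrite !mxE.
Qed.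

Lemma rspan0 (D : unitRingType) n (b : nat -> 'cV[D]_n) :
  rspan b 0 = [set 0].
Proof.
apply/seteqP; split=> [_ [x _ <-]|_ ->] /=; first by rewrite /rcomb big_ord0.
by exists (fun=> 0) => //; rewrite /rcomb big_ord0.
Qed.

Lemma rspanS (D : unitRingType) n (b : nat -> 'cV[D]_n) j u :
  rspan b j.+1 u <-> exists2 w, rspan b j w & exists a, u = w + rscale (b j) a.
Proof.
split=> [[x _ <-]|[_ [x _ <-]] [a ->]].
  rewrite /rcomb big_ord_recr /=; eexists; last by eexists; reflexivity.
  by exists (fun k => x (widen_ord (leqnSn j) k)).
exists (fun k : 'I_j.+1 => oapp x a (insub (val k))) => //.
rewrite /rcomb big_ord_recr /= insubF ?ltnn //; congr (_ + _).
apply: eq_bigr => k _; rewrite insubT //= => kj.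
by congr (rscale _ (x _)); exact: val_inj.
Qed.

Lemma rspan_rsubspace (D : unitRingType) n (b : nat -> 'cV[D]_n) j :
  rsubspace (rspan b j).
Proof.
split=> [|_ _ [x _ <-] [y _ <-]|_ a [x _ <-]].
- exists (fun=> 0) => //; rewrite /rcomb big1 // => k _.
  by apply/matrixP => i l; rewrite !mxE mulr0.
- exists (fun k => x k + y k) => //; rewrite /rcomb -big_split.
  by apply: eq_bigr => k _; apply/matrixP => i l; rewrite !mxE mulrDr.
- exists (fun k => x k * a) => //; apply/matrixP => i l.
  rewrite mxE /rcomb !summxE mulr_suml; apply: eq_bigr => k _.
  by rewrite !mxE mulrA.
Qed.

Lemma eq_rspan (D : unitRingType) n (b b' : nat -> 'cV[D]_n) j :
  (forall k, (k < j)%N -> b k = b' k) -> rspan b j = rspan b' j.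
Proof.
move=> ebb; rewrite /rspan.
suff -> : first_vectors b (j := j) = first_vectors b' (j := j) by [].
by apply: funext => k; exact: ebb.
Qed.

Lemma rfreeS (D : unitRingType) n (b : nat -> 'cV[D]_n) j :
  division_ring D -> rfree (first_vectors b (j := j)) -> ~ rspan b j (b j) ->
  rfree (first_vectors b (j := j.+1)).
Proof.
move=> hD fb nbj x; rewrite /rcomb big_ord_recr /= => bx0.
pose x' k := x (widen_ord (leqnSn j) k).
have {}bx0 : rcomb (first_vectors b (j := j)) x' + rscale (b j) (x ord_max) = 0.
  exact: bx0.
have [xm0|/hD um] := eqVneq (x ord_max) 0.
  have x'0 : forall k, x' k = 0.
    apply: fb; rewrite -[RHS]bx0 xm0 -[LHS]addr0; congr (_ + _).
    by apply/matrixP => i l; rewrite !mxE mulr0.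
  move=> k; have [kj|jk] := ltnP k j.
    by rewrite -(x'0 (Ordinal kj)); congr x; exact: val_inj.
  rewrite -xm0; congr x; apply: val_inj => /=.
  by apply/eqP; rewrite eqn_leq jk -ltnS ltn_ord.
case: nbj; have [W0 _ WZ] := rspan_rsubspace b j.
have := WZ _ (x ord_max)^-1 (rsubspaceB (rspan_rsubspace b j) W0
  (ex_intro2 _ _ x' I erefl)).
congr (rspan _ _ _).
move/eqP: bx0; rewrite addr_eq0 => /eqP ->; rewrite sub0r opprK.
by apply/matrixP => i l; rewrite !mxE -mulrA mulrV // mulr1 [l]ord1.
Qed.

(** If [j] vectors spanned the space, the matrix that they form would have a right
    inverse [X] of size [j] by [n], which is impossible since [X] has a nonzero
    kernel when [j < n]. *)
Lemma rspan_proper (D : unitRingType) n (b : nat -> 'cV[D]_n) j :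
  division_ring D -> (j < n)%N -> exists u, ~ rspan b j u.
Proof.
move=> hD jn; apply: contrapT => nex.
have full u : exists x, rcomb (first_vectors b (j := j)) x = u.
  apply: contrapT => nx; apply: nex; exists u => -[x _ xu].
  by apply: nx; exists x.
have [X eX] := choice full.
have [y ny0 Xy0] := wide_kernel (\matrix_(k, i) X (delta_mx i 0) k) hD jn.
case/eqP: ny0; rewrite -[y]mul1mx.
suff <- : (\matrix_(i, k) b (nat_of_ord k) i ord0) *m
    (\matrix_(k, i) X (delta_mx i 0) k) = 1%:M.
  by rewrite -mulmxA Xy0 mulmx0.
apply/matrixP => i l.
have := congr1 (fun A : 'cV_n => A i ord0) (eX (delta_mx l 0)).
rewrite rcomb_mulmx !mxE andbT => <-.
by apply: eq_bigr => k _; rewrite !mxE.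
Qed.

(** A vector outside the span would extend the family to [n + 1] free vectors, in
    contradiction with [wide_kernel]. *)
Lemma rspan_full (D : unitRingType) n (b : nat -> 'cV[D]_n) :
  division_ring D -> rfree (first_vectors b (j := n)) -> rspan b n = setT.
Proof.
move=> hD fb; apply/seteqP; split=> // u _; apply: contrapT => nu.
pose b' k := if k == n then u else b k.
have bb' k : (k < n)%N -> b k = b' k by rewrite /b'; case: ltngtP.
have fbb : first_vectors b (j := n) = first_vectors b' (j := n).
  by apply: funext => k; exact: bb'.
have fb' : rfree (first_vectors b' (j := n.+1)).
  apply: rfreeS => //; first by rewrite -fbb.
  by rewrite -(eq_rspan bb') /b' eqxx.
have [y ny0 By0] := wide_kernel
  (\matrix_(i, k) first_vectors b' (j := n.+1) k i ord0) hD (ltnSn n).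
case/eqP: ny0; apply/matrixP => k l; rewrite [l]ord1 mxE.
apply: (fb' (fun k => y k ord0)); rewrite rcomb_mulmx -[RHS]By0.
by congr (_ *m _); apply/matrixP => i m; rewrite mxE [m]ord1.
Qed.

(** * Triangularization *)

(** A central eigenvalue moves past the coordinates of [b j], so [A] maps
    [(b j) a] to [(b j) (d a)] modulo the span of the preceding vectors. *)
Lemma rspanS_invariant (D : unitRingType) n (S : set 'M[D]_n)
    (b : nat -> 'cV[D]_n) j :
    Defs.invariant S (rspan b j) ->
    (forall A, S A -> exists2 d, central d & rspan b j (A *m b j - d *: b j)) ->
  Defs.invariant S (rspan b j.+1).
Proof.
move=> Sb Sv A u SA /rspanS[w bw [a ->]]; apply/rspanS.
have [_ WD WZ] := rspan_rsubspace b j; have [d cd bd] := Sv A SA.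
exists (A *m w + rscale (A *m b j - d *: b j) a).
  by apply: WD; [exact: Sb | exact: WZ].
exists (d * a); rewrite mulmxDr -addrA; congr (_ + _).
apply/matrixP => i l; rewrite !mxE mulrBl (cd (b j i ord0)) -!mulrA subrK.
by rewrite mulr_suml; apply: eq_bigr => k _; rewrite !mxE mulrA.
Qed.

Lemma partial_triangularization (D : unitRingType) n (S : set 'M[D]_n) :
    division_ring D -> mx_semigroup S -> finite_set S -> S 1 ->
    (forall A, S A -> exists c, eigen A c) ->
  forall j, (j <= n)%N -> exists b : nat -> 'cV[D]_n,
    forall i, (i <= j)%N ->
      rfree (first_vectors b (j := i)) /\ Defs.invariant S (rspan b i).
Proof.
move=> hD hS fS S1 eS; elim=> [_|j IHj jn].
  exists (fun=> 0) => i; rewrite leqn0 => /eqP ->; split=> [x _ []//|].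
  by rewrite rspan0 => A v _ /= ->; rewrite mulmx0.
have [b hb] := IHj (ltnW jn); have [fb Sb] := hb j (leqnn j).
have [v nbv Sv] := semigroup_eigenvector hD (leq_ltn_trans (leq0n j) jn) hS fS
  S1 eS (rspan_rsubspace b j) Sb (rspan_proper b hD jn).
pose b' k := if k == j then v else b k.
have b'j : b' j = v by rewrite /b' eqxx.
have bb' i k : (i <= j)%N -> (k < i)%N -> b k = b' k.
  by move=> ij /leq_trans/(_ ij); rewrite /b'; case: ltngtP.
have ebb' i : (i <= j)%N -> rspan b i = rspan b' i.
  by move=> ij; apply: eq_rspan => k; exact: bb'.
have fbb' i : (i <= j)%N -> rfree (first_vectors b' (j := i)).
  move=> ij; have [fbi _] := hb i ij.
  suff <- : first_vectors b (j := i) = first_vectors b' (j := i) by [].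
  by apply: funext => k; exact: (bb' i).
exists b' => i; rewrite leq_eqVlt => /predU1P[->|ij]; last first.
  by split; [exact: fbb' | rewrite -ebb' //; exact: proj2 (hb i ij)].
split; first by apply: rfreeS; rewrite -?ebb' ?b'j //; exact: fbb'.
by apply: rspanS_invariant; rewrite -ebb' // b'j.
Qed.

Theorem theorem2p2 (D : unitRingType) (hD : division_ring D)
    (n : nat) (hn : (1 < n)%N) (S : set 'M[D]_n)
    (S_semigroup : mx_semigroup S) (S_finite : finite_set S)
    (S_form : forall A : 'M[D]_n, S A ->
       exists (c : D) (N : 'M[D]_n),
         [/\ central c, nilpotent_mx N & A = c%:M + N]) :
  triangularizable S.
Proof.
pose S1 := S `|` [set 1].
have hS1 : mx_semigroup S1.
  move=> A B [SA|->] [SB|->]; rewrite ?mulmx1 ?mul1mx; [left|left|left|right] => //.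
  exact: S_semigroup.
have fS1 : finite_set S1 by rewrite finite_setU.
have eS1 A : S1 A -> exists c, eigen A c.
  move=> [/S_form[c [N [cc nilN ->]]]|->].
    by exists c; split=> //; rewrite addrAC subrr add0r.
  by exists 1; split; [exact: central1 | exists 1%N; rewrite expr1 subrr].
have [b hb] :=
  partial_triangularization hD hS1 fS1 (or_intror erefl) eS1 (leqnn n).
exists (rspan b); split.
- exact: rspan0.
- by apply: rspan_full => //; exact: proj1 (hb n (leqnn n)).
- move=> j _ u bu; apply/rspanS; exists u => //; exists 0.
  by apply/matrixP => i l; rewrite !mxE mulr0 [l]ord1 addr0.
- move=> j jn; have [fb Sb] := hb j jn; split.
  + exact: rspan_rsubspace.
  + by exists (first_vectors b (j := j)).
  + by move=> A v SA; apply: Sb; left.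
Qed.
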